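(* Let $G$ be a finite simple graph with $V(G)=\{1,\dots,n\}$, edge weight function $w$ and vertex weight function $w_1$. Let $\Gamma(c)$ be the set of all nonempty subgraphs of $G$ that are disjoint unions of cycles (each of length at least $3$). Then $$\phi_{(w,w_1)}(G,x)=\eta_{(w,w_1)}(G,x)+\sum_{C\in\Gamma(c)}(-1)^{\mathrm{comp}(C)}w_2(C)\,\eta_{(w,w_1)}(G\setminus C,x).$$ In particular $\phi_{(w,w_1)}(G,x)$ has real coefficients.
   Context: An edge weight function $w$ assigns a nonzero complex number to each edge; a vertex weight function $w_1$ assigns a real number (possibly $0$) to each vertex; subgraphs carry restricted weights. $G\setminus C$ deletes all vertices of $C$ (and incident edges). For $A\subseteq E(G)$, $w(A)=\prod_{e\in A}w(e)$. $\mu_w(G,x)=\sum_{M}(-1)^{|M|}|w(M)|^2x^{n-2|M|}$ over all matchings $M$ (including empty). $\eta_{(w,w_1)}(G,x)=\sum_{S\subseteq V(G)}(-1)^{|V(G)\setminus S|}\big(\prod_{v\in V(G)\setminus S}w_1(v)\big)\mu_w(G[S],x)$ with $G[S]$ the induced subgraph; $\mu_w$ and $\eta_{(w,w_1)}$ of the empty graph are $1$. The weighted adjacency matrix $B=[b_{uv}]$ is the $n\times n$ matrix with $b_{uv}=w(e_{uv})$ if $uv$ is an edge and $u<v$, $b_{uu}=w_1(u)$, $b_{uv}=\overline{w(e_{vu})}$ if $vu$ is an edge and $u>v$, and $b_{uv}=0$ otherwise (so $B$ is Hermitian); $\phi_{(w,w_1)}(G,x)=\det(xI-B)$. For a cycle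 $C=v_1v_2\cdots v_mv_1$ ($m\ge3$), $w_2(C)=b_{v_1v_2}b_{v_2v_3}\cdots b_{v_mv_1}+b_{v_1v_m}b_{v_mv_{m-1}}\cdots b_{v_2v_1}$ (a real number); for a disjoint union $C=C_1\cup\dots\cup C_k$ of cycles, $w_2(C)=\prod_j w_2(C_j)$. $\mathrm{comp}(C)$ is the number of connected components of $C$. *)

(* Defs.v *)
(* Complex numbers are modelled by an arbitrary
   numClosedFieldType C (which includes the complex numbers). *)
From HB Require Import structures.
From Stdlib Require Import ClassicalEpsilon.
From mathcomp Require Import all_boot all_order all_algebra.
Set Implicit Arguments. Unset Strict Implicit. Unset Printing Implicit Defensive.
Import Order.TTheory GRing.Theory Num.Theory.
Local Open Scope ring_scope.

Section Defs.
Variables (n : nat) (C : numClosedFieldType) (adj : rel 'I_n)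
  (w : {set 'I_n} -> C) (w1 : 'I_n -> C).

(* an edge of G, as an unordered pair {u,v} *)
Definition is_edge (e : {set 'I_n}) : bool :=
  [exists u, exists v, adj u v && (e == [set u; v])].

(* weighted adjacency matrix B *)
Definition bw (u v : 'I_n) : C :=
  if u == v then w1 u
  else if adj u v then
    (if (u < v)%N then w [set u; v] else (w [set u; v])^*)
  else 0.
Definition Bmx : 'M[C]_n := \matrix_(u, v) bw u v.
Definition phiw : {poly C} := char_poly Bmx.

(* M is a matching of the induced subgraph G[S] *)
Definition matching (S : {set 'I_n}) (M : {set {set 'I_n}}) : bool :=
  [forall e in M, is_edge e && (e \subset S)] &&
  [forall e1 in M, forall e2 in M, (e1 != e2) ==> [disjoint e1 & e2]].

(* matching polynomial of G[S] *)
Definition muw (S : {set 'I_n}) : {poly C} :=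
  \sum_(M : {set {set 'I_n}} | matching S M)
     ((-1) ^+ #|M| * `|\prod_(e in M) w e| ^+ 2) *: 'X^(#|S| - (#|M|).*2).

(* eta of the induced subgraph G[U] *)
Definition etaw (U : {set 'I_n}) : {poly C} :=
  \sum_(S : {set 'I_n} | S \subset U)
     ((-1) ^+ #|U :\: S| * \prod_(v in U :\: S) w1 v) *: muw S.

(* a cycle v1 v2 ... vm v1 of G (m >= 3), given as the sequence of its vertices *)
Definition cyc (s : seq 'I_n) : bool :=
  [&& uniq s, (2 < size s)%N & cycle adj s].
Definition cedges (s : seq 'I_n) : {set {set 'I_n}} :=
  [set [set p.1; p.2] | p in zip s (rot 1 s)].
Definition w2seq (s : seq 'I_n) : C :=
  \prod_(p <- zip s (rot 1 s)) bw p.1 p.2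
  + \prod_(p <- zip (rev s) (rot 1 (rev s))) bw p.1 p.2.

(* ss is a decomposition of the edge set F into vertex-disjoint cycles *)
Definition decomp (F : {set {set 'I_n}}) (ss : seq (seq 'I_n)) : Prop :=
  [/\ all cyc ss, pairwise (fun s t => [disjoint s & t]) ss &
      F = \bigcup_(s <- ss) cedges s].

(* Gamma(c): nonempty subgraphs that are disjoint unions of cycles
   (a subgraph without isolated vertices is determined by its edge set F) *)
Definition inGamma (F : {set {set 'I_n}}) : Prop :=
  F != set0 /\ exists ss, decomp F ss.
Definition inGammab (F : {set {set 'I_n}}) : bool :=
  if excluded_middle_informative (inGamma F) then true else false.

(* a (chosen) cycle decomposition of F, when one exists *)
Definition dec (F : {set {set 'I_n}}) : seq (seq 'I_n) :=
  match excluded_middle_informative (exists ss, decomp F ss) with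
  | left h => proj1_sig (constructive_indefinite_description _ h)
  | right _ => [::]
  end.

(* w2(C) = product of w2 over the cycles of C *)
Definition w2 (F : {set {set 'I_n}}) : C := \prod_(s <- dec F) w2seq s.

(* vertex set of the subgraph with edge set F *)
Definition VF (F : {set {set 'I_n}}) : {set 'I_n} := \bigcup_(e in F) e.

(* number of connected components of the subgraph (V(F), F) *)
Definition ncomp (F : {set {set 'I_n}}) : nat :=
  n_comp (fun u v : 'I_n => [set u; v] \in F) (mem (VF F)).

End Defs.

(* Main.v *)
(* Expand det(xI - B) over permutations and group the permutations p by the set
   F of edges traversed by their cycles of length at least 3.  A nonzero term
   forces F to be empty or in Gamma(c).  If F contains a cycle C then p follows C
   in one of its two directions; splitting off the corresponding cyclic
   permutation, of sign (-1)^(m-1) with m entries -b, gives the factor -w_2(C) and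
   leaves the same sum over V \ C for F minus C.  Once F is exhausted, the
   permutations left are involutions, that is, matchings, and their sum is eta
   after expanding the diagonal factors x - w_1(v). *)
Require Import Defs.
From HB Require Import structures.
From Stdlib Require Import ClassicalEpsilon.
From mathcomp Require Import all_boot all_order all_algebra.
From mathcomp Require Import fingroup perm.
Import Order.TTheory GRing.Theory Num.Theory.
Local Open Scope ring_scope.
Set Implicit Arguments.
Unset Strict Implicit.
Unset Printing Implicit Defensive.

(** * Cyclic permutations attached to duplicate-free sequences *)

Section CyclicPerm.
Variable T : finType.
Implicit Types (s : seq T) (x y z : T) (c p q : {perm T}) (U A : {set T}).

(** A product of transpositions through the common point [x], so that its sign can be read off from
    the number of factors. *)
Fixpoint cperm_rec x s : {perm T} :=
  if s is y :: s' then (tperm x y * cperm_rec x s')%g else 1%g.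

Definition cperm s : {perm T} := if s is x :: s' then cperm_rec x s' else 1%g.

(** Products apply the left factor first: [tperm x y] sends [x] to [y], which the later factors fix,
    and [y] to [x], which then continues along [x :: s]. *)
Lemma cpermE s : uniq s -> cperm s =1 next s.
Proof.
case: s => [|x s] /=; first by move=> _ z; rewrite perm1.
elim: s => [|y s IH] /= U z; first by rewrite perm1 /=; case: eqP.
have {}IH : cperm_rec x s =1 next (x :: s).
  by apply: IH; move: U; rewrite inE negb_or -!andbA => /and4P[_ -> _ ->].
move: U; rewrite inE negb_or -andbA => /and4P[xy xs ys us].
rewrite permM IH; case: tpermP => [->|->|/eqP zx /eqP zy].
- by rewrite next_nth inE (negPf ys) eq_sym (negPf xy) /= eqxx.
- by rewrite !next_nth !inE !eqxx orbT /= ?(negPf xy) ?eqxx.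
- by rewrite !next_nth !inE /= (negPf zx) (negPf zy) /= ![_ == z]eq_sym (negPf zx) (negPf zy).
Qed.

Lemma odd_cperm s : uniq s -> s != [::] -> odd_perm (cperm s) = ~~ odd (size s).
Proof.
case: s => [|x s] //= + _; rewrite negbK.
elim: s => [|y s IH] /= U; first by rewrite odd_perm1.
move: U; rewrite inE negb_or -andbA => /and4P[xy xs ys us].
by rewrite odd_permM odd_tperm xy IH // xs.
Qed.

Lemma zip_rot1 s : uniq s -> zip s (rot 1 s) = [seq (x, next s x) | x <- s].
Proof.
move=> us; have -> : rot 1 s = map (next s) s.
  case: s us => [|x0 s] // us; apply: (@eq_from_nth _ x0).
    by rewrite size_rot size_map.
  move=> i; rewrite size_rot => lti; rewrite (nth_map x0) // next_nth mem_nth //.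
  rewrite index_uniq // rot1_cons nth_rcons; move: lti => /=; rewrite ltnS leq_eqVlt.
  (* At the last entry [next] reads past the tail and returns the default value, which is the head:
     the cycle closes up. *)
  case/predU1P => [->|lti]; first by rewrite ltnn eqxx nth_default.
  by rewrite lti; apply: set_nth_default.
by rewrite -{1}[s]map_id zip_map.
Qed.

(** The orbit of [x] under [next s] is all of [s], so a property can be carried around the cycle
    from one point. *)
Lemma next_closed_all s (P : pred T) x : uniq s -> x \in s -> P x ->
  (forall y, y \in s -> P y -> P (next s y)) -> forall y, y \in s -> P y.
Proof.
move=> us xs Px HP y ys.
have : fconnect (next s) x y by rewrite (fconnect_cycle (cycle_next us)).
move/iter_findex => <-; elim: (findex _ _ _) => [|m] //=.
have : iter m (next s) x \in s.
  by elim: m => //= m; rewrite mem_next.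
exact: HP.
Qed.

Lemma next_neq s x : uniq s -> (1 < size s)%N -> x \in s -> next s x != x.
Proof.
move=> us sz xs; apply/negP => /eqP nx.
have all_x : forall y, y \in s -> y == x.
  apply: (@next_closed_all s (pred1 x) x) => //=.
  by move=> y _ /eqP ->; rewrite nx.
have : (size s <= size [:: x])%N.
  by apply: uniq_leq_size => // y /all_x; rewrite inE.
by rewrite leqNgt sz.
Qed.

(** Otherwise [x] and [next s x] would form a set closed under [next s], leaving room for two
    entries only. This is what separates the two directions of a cycle. *)
Lemma next2_neq s x : uniq s -> (2 < size s)%N -> x \in s ->
  next s (next s x) != x.
Proof.
move=> us sz xs; apply/negP => /eqP nx.
have all_x : forall y, y \in s -> (y == x) || (y == next s x).
  apply: (@next_closed_all s (pred2 x (next s x)) x) => //=; first by rewrite eqxx.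
  by move=> y _ /orP[] /eqP ->; rewrite ?nx eqxx ?orbT.
have : (size s <= size [:: x; next s x])%N.
  by apply: uniq_leq_size => // y /all_x; rewrite !inE.
by rewrite leqNgt sz.
Qed.

Lemma cperm_on s : uniq s -> perm_on [set x in s] (cperm s).
Proof.
by move=> us; apply/subsetP => x; rewrite !inE cpermE // next_nth; case: ifP; rewrite ?eqxx.
Qed.

End CyclicPerm.

(** * Leibniz terms of principal submatrices *)

Section PermTerm.
Variables (T : finType) (R : comNzRingType) (a : T -> T -> R).
Implicit Types (p q c : {perm T}) (U A : {set T}).

(** For [p] supported in [U] this is a term of the principal minor on [U]; keeping [p] a permutation
    of all of [T] avoids a change of type when vertices are deleted. *)
Definition pterm U p : R := (-1) ^+ odd_perm p * \prod_(i in U) a i (p i).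

Lemma ptermM A U c p : A \subset U -> perm_on A c -> perm_on (U :\: A) p ->
  pterm U (c * p)%g = pterm A c * pterm (U :\: A) p.
Proof.
move=> sAU cA pUA; rewrite /pterm odd_permM signr_addb mulrACA; congr (_ * _).
rewrite (big_setID A) /= (setIidPr sAU); congr (_ * _); apply: eq_bigr => i.
  move=> iA; rewrite permM (out_perm pUA) //.
  by rewrite inE negb_and negbK (perm_closed _ cA) iA.
by rewrite inE => /andP[iA _]; rewrite permM (out_perm cA).
Qed.

(* The permutations of U agreeing with c on A are the c * p, p a permutation of U \ A. *)
Lemma sum_pterm_peel A U c (P P' : pred {perm T}) : A \subset U -> perm_on A c ->
  (forall p, perm_on (U :\: A) p -> P (c * p)%g = P' p) ->
  \sum_(p | [&& perm_on U p, P p & [forall i in A, p i == c i]]) pterm U p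
  = pterm A c * \sum_(p | perm_on (U :\: A) p && P' p) pterm (U :\: A) p.
Proof.
move=> sAU cA PP'; rewrite (reindex_inj (mulgI c)) big_distrr /=.
have offA p : [forall i in A, (c * p)%g i == c i] -> perm_on U (c * p)%g ->
    perm_on (U :\: A) p.
  move=> /forall_inP fp pU; apply/subsetP=> i; rewrite inE => pi.
  have iA : i \notin A.
    apply: contraNN pi => iA.
    (* At the preimage of [i] under [c], agreement of [c * p] with [c] says that [p] fixes [i]. *)
    have jA : (c^-1)%g i \in A by rewrite (perm_closed _ (perm_onV cA)).
    by have := fp _ jA; rewrite permM permKV.
  rewrite inE iA; apply: contraNT pi => iU.
  by rewrite -{2}(out_perm pU iU) permM (out_perm cA).
have onUA p : perm_on (U :\: A) p -> perm_on U (c * p)%g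
    && [forall i in A, (c * p)%g i == c i].
  move=> pUA; apply/andP; split.
    apply: perm_onM; [exact: subset_trans cA sAU|exact: subset_trans pUA (subsetDl _ _)].
  apply/forall_inP => i iA; rewrite permM (out_perm pUA) //.
  by rewrite inE negb_and negbK (perm_closed _ cA) iA.
apply: eq_big => [p|p /and3P[pU _ fp]]; last by apply: ptermM => //; apply: offA.
apply/and3P/andP => [[pU Pp fp]|[pUA P'p]].
  by have pUA := offA _ fp pU; rewrite pUA -PP'.
by have /andP[-> ->] := onUA _ pUA; rewrite PP' // P'p.
Qed.

End PermTerm.

(** * Unordered pairs and the edges traversed by a permutation *)

Lemma set2_inj (T : finType) (i j k l : T) : k != l -> [set i; j] = [set k; l] ->
  (i = k /\ j = l) \/ (i = l /\ j = k).
Proof.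
move=> kl E; have /set2P[ik|il] : i \in [set k; l] by rewrite -E set21.
  left; split=> //; have /set2P[li|->//] : l \in [set i; j] by rewrite E set22.
  by rewrite li ik eqxx in kl.
right; split=> //; have /set2P[ki|->//] : k \in [set i; j] by rewrite E set21.
by rewrite ki il eqxx in kl.
Qed.

Section PermEdges.
Variable T : finType.
Implicit Types (p c : {perm T}) (A U : {set T}) (k : nat).

(** Points whose cycle length divides [k] are dropped; the parameter lets the two cases of interest
    share their lemmas. *)
Definition pedges k p : {set {set T}} := [set [set i; p i] | i : T & iter k p i != i].

Lemma pedgesP {k p e} :
  reflect (exists2 i, iter k p i != i & e = [set i; p i]) (e \in pedges k p).
Proof.
apply: (iffP imsetP) => [[i]|[i pi ->]]; last by exists i; rewrite // inE.
by rewrite inE => pi ->; exists i.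
Qed.

Lemma pedges_on k A p e : perm_on A p -> e \in pedges k p -> e \subset A.
Proof.
move=> pA /pedgesP[i pi ->]; rewrite subUset !sub1set (perm_closed _ pA) andbb.
apply: contraNT pi => iA; elim: k => //= k /eqP ->.
by rewrite (out_perm pA).
Qed.

(** The supports are disjoint, so iterates of [c * p] are those of [c] on [A] and those of [p]
    elsewhere. *)
Lemma pedgesM k A c p : perm_on A c -> perm_on (~: A) p ->
  pedges k (c * p)%g = pedges k c :|: pedges k p.
Proof.
move=> cA pA; have pE i : i \in A -> p i = i.
  by move=> iA; rewrite (out_perm pA) // inE iA.
have cE i : i \notin A -> c i = i by apply: out_perm.
have kE i : iter k (c * p)%g i = if i \in A then iter k c i else iter k p i.
  have [iA|iA] := boolP (i \in A); elim: k => //= k ->; rewrite permM.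
    by rewrite pE // (perm_closed _ cA); elim: k => //= k; rewrite (perm_closed _ cA).
  rewrite cE //; elim: k => //= k.
  by rewrite -!in_setC (perm_closed _ pA).
have kpE i : i \in A -> iter k p i = i.
  by move=> iA; elim: k {kE} => //= k ->; apply: pE.
have kcE i : i \notin A -> iter k c i = i.
  by move=> iA; elim: k {kE kpE} => //= k ->; apply: cE.
apply/setP => e; rewrite inE; apply/pedgesP/orP.
  case=> i; rewrite kE permM; have [iA|iA] := boolP (i \in A).
    rewrite pE ?(perm_closed _ cA) // => ci ->; left.
    by apply/pedgesP; exists i.
  by rewrite cE // => pi ->; right; apply/pedgesP; exists i.
case=> /pedgesP[i pi ->]; exists i; rewrite ?kE ?permM //;
  have [iA|iA] := boolP (i \in A) => //.
- by rewrite (kcE _ iA) eqxx in pi.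
- by rewrite pE ?(perm_closed _ cA).
- by rewrite (kcE _ iA) eqxx in pi.
- by rewrite (kpE _ iA) eqxx in pi.
- by rewrite (kpE _ iA) eqxx in pi.
- by rewrite cE.
Qed.

Lemma pedges_disjoint k A U p e : perm_on (U :\: A) p -> e \in pedges k p ->
  [disjoint e & A].
Proof.
move=> pUA /(pedges_on pUA); rewrite subsetD => /andP[_ ?]; exact.
Qed.

End PermEdges.

(* [ledges p] comes from the cycles of p of length at least 3, [medges p] from all nontrivial ones. *)
Notation ledges := (pedges 2).
Notation medges := (pedges 1).

(** * Splitting one cycle off a sum over permutations *)

Section CyclePeel.
Variable n : nat.
Implicit Types (s : seq 'I_n) (p : {perm 'I_n}) (U : {set 'I_n}) (F : {set {set 'I_n}}).

Lemma cedgesP s e : uniq s ->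
  reflect (exists2 y, y \in s & e = [set y; next s y]) (e \in cedges s).
Proof.
move=> us; rewrite /cedges zip_rot1 //; apply: (iffP imsetP).
  by case=> _ /mapP[y ys ->] ->; exists y.
by case=> y ys ->; exists (y, next s y) => //; apply/mapP; exists y.
Qed.

Lemma cedges_rev s : uniq s -> cedges (rev s) = cedges s.
Proof.
move=> us; apply/setP => e.
apply/(cedgesP _ (etrans (rev_uniq s) us))/(cedgesP _ us) => -[y].
  rewrite mem_rev next_rev // => ys ->; exists (prev s y); first by rewrite mem_prev.
  by rewrite next_prev // setUC.
move=> ys ->; exists (next s y); first by rewrite mem_rev mem_next.
by rewrite next_rev // prev_next // setUC.
Qed.

Lemma ledges_cperm s : uniq s -> (2 < size s)%N -> ledges (cperm s) = cedges s.
Proof.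
move=> us sz; apply/setP => e; apply/pedgesP/(cedgesP _ us) => -[y].
  rewrite /= !cpermE // => ny ->; exists y => //.
  by apply: contraNT ny => ys; rewrite !next_nth !(negPf ys).
by move=> ys ->; exists y; rewrite /= !cpermE // next2_neq.
Qed.

Lemma cedges_disjoint s e : uniq s -> e \in cedges s -> ~~ [disjoint e & s].
Proof.
move=> us /(cedgesP _ us)[y ys ->]; apply/pred0Pn; exists y.
by rewrite /= set21.
Qed.

Section OneCycle.
Variables (s : seq 'I_n) (F : {set {set 'I_n}}) (p : {perm 'I_n}).
Hypotheses (us : uniq s) (sz : (2 < size s)%N).
Hypothesis dF : forall e, e \in F -> [disjoint e & s].
Hypothesis pF : ledges p = cedges s :|: F.

(** Some edge from [k] to [p k], with [k] on a long cycle, contains [i]; injectivity of [p]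
    transports the inequality from [k] to [p k]. *)
Lemma ledges_mem_long i : i \in s -> p (p i) != i.
Proof.
move=> si; have : [set i; next s i] \in ledges p.
  by rewrite pF inE; apply/orP; left; apply/(cedgesP _ us); exists i.
case/pedgesP => k pk E; have : i \in [set k; p k] by rewrite -E set21.
by rewrite !inE => /orP[]/eqP-> //; rewrite (inj_eq perm_inj).
Qed.

(** The edge from [i] to [p i] lies in [cedges s] because [F] avoids [s], and along [s] the point
    [i] has only these two neighbours. *)
Lemma ledges_next_or_prev i : i \in s -> p i = next s i \/ p i = prev s i.
Proof.
move=> si; have : [set i; p i] \in cedges s :|: F.
  by rewrite -pF; apply/pedgesP; exists i => //; apply: ledges_mem_long.
case/setUP => [/(cedgesP _ us)[k sk]|/dF/pred0P/(_ i)]; last by rewrite /= set21 si.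
case/set2_inj=> [|[-> ->]|[-> ->]]; last by right; rewrite prev_next.
  by rewrite eq_sym next_neq // ltnW.
by left.
Qed.

Lemma ledges_next x : x \in s -> p x = next s x -> {in s, forall i, p i = next s i}.
Proof.
move=> xs px i si; apply/eqP; move: i si.
apply: (@next_closed_all _ s (fun i => p i == next s i) x) => //; first exact/eqP.
move=> i si /eqP pi; have nis : next s i \in s by rewrite mem_next.
(* otherwise p exchanges i and next s i, a cycle of length 2 *)
have [->//|] := ledges_next_or_prev nis.
rewrite prev_next // => E; have := ledges_mem_long si.
by rewrite pi E eqxx.
Qed.

End OneCycle.

Variables (R : comNzRingType) (a : 'I_n -> 'I_n -> R).

Definition lsum U F := \sum_(p | perm_on U p && (ledges p == F)) pterm a U p.

(** By [ledges_next] the test at the single point [x] already forces agreement with [cperm s] on all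
    of [s], so [sum_pterm_peel] applies. *)
Lemma sum_ledges_peel U s x F : uniq s -> (2 < size s)%N -> x \in s ->
  [set y in s] \subset U -> (forall e, e \in F -> [disjoint e & s]) ->
  \sum_(p | [&& perm_on U p, ledges p == cedges s :|: F & p x == next s x])
     pterm a U p
  = pterm a [set y in s] (cperm s) * lsum (U :\: [set y in s]) F.
Proof.
move=> us sz xs sU dF; set A := [set y in s].
have cA : perm_on A (cperm s) by apply: cperm_on.
rewrite -(sum_pterm_peel (P := fun p => ledges p == cedges s :|: F) a sU cA).
  apply: eq_bigl => p; congr (_ && _); have [pF|//] := eqVneq (ledges p) _.
  apply/eqP/forall_inP => [px i|/(_ x)]; rewrite inE ?cpermE //; last by move/(_ xs)/eqP.
  by move=> si; apply/eqP; apply: (ledges_next us sz dF pF xs).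
move=> p pUA; rewrite (pedgesM _ cA) ?ledges_cperm //; last first.
  by apply: subset_trans pUA _; rewrite setDE subsetIr.
apply/eqP/eqP => [E|->//].
(* The long edges of [p] avoid [s], as do those of [F], while every edge of [s] meets [s]; hence
   [cedges s] cancels from the two unions. *)
have dp e : e \in ledges p -> [disjoint e & s].
  move=> /(pedges_on pUA) /subsetP eUA; apply/pred0P => i /=; apply/negP => /andP[/eUA].
  by rewrite !inE => /andP[/negP].
apply/setP => e; have /setP/(_ e) := E; rewrite !inE.
have [ec|//] := boolP (e \in cedges s) => _.
by apply/idP/idP => [/dp|/dF]; rewrite (negPf (cedges_disjoint us ec)).
Qed.

(** The permutations are split by their direction at one point [x]. Those going backward are the
    forward ones for [rev s], which has the same edges. *)
Lemma lsum_peel U s F : uniq s -> (2 < size s)%N ->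
  [set y in s] \subset U -> (forall e, e \in F -> [disjoint e & s]) ->
  lsum U (cedges s :|: F) =
    (pterm a [set y in s] (cperm s) + pterm a [set y in s] (cperm (rev s)))
    * lsum (U :\: [set y in s]) F.
Proof.
move=> us sz sU dF.
have [x xs] : exists x, x \in s by case: s sz {us sU dF} => // x s' _; exists x; rewrite inE eqxx.
have rs : [set y in rev s] = [set y in s] by apply/setP => y; rewrite !inE mem_rev.
rewrite mulrDl -(sum_ledges_peel us sz xs sU dF) -rs.
rewrite -(@sum_ledges_peel U (rev s) x F) ?rev_uniq ?size_rev ?mem_rev ?rs //; last first.
  by move=> e /dF; rewrite !(disjoint_sym e) (eq_disjoint (mem_rev s)).
rewrite /lsum (bigID (fun p : {perm 'I_n} => p x == next s x)) /=; congr (_ + _).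
  by apply: eq_bigl => p; rewrite andbA.
apply: eq_bigl => p; rewrite cedges_rev // -andbA; congr (_ && _).
have [pF|//] := eqVneq (ledges p) _; rewrite next_rev //=.
have np : next s x != prev s x.
  apply: contra_neq (next2_neq us sz xs) => E; by rewrite E next_prev.
by have [->|->] := ledges_next_or_prev us sz dF pF xs; rewrite eqxx ?(negPf np) // eq_sym np.
Qed.

End CyclePeel.

(** * Decompositions of an edge set into disjoint cycles *)

Lemma mem_bigcup_seq (I : eqType) (T : finType) (r : seq I) (f : I -> {set T}) x :
  reflect (exists2 i, i \in r & x \in f i) (x \in \bigcup_(i <- r) f i).
Proof.
elim: r => [|i r IH]; first by rewrite big_nil inE; constructor => -[].
rewrite big_cons inE; apply: (iffP orP) => [[xi|/IH[j jr xj]]|[j]].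
- by exists i; rewrite ?mem_head.
- by exists j; rewrite // inE jr orbT.
- by rewrite inE => /predU1P[->|jr xj]; [left|right; apply/IH; exists j].
Qed.

Section Decompositions.
Variables (n : nat) (adj : rel 'I_n).
Implicit Types (s : seq 'I_n) (ss : seq (seq 'I_n)) (F : {set {set 'I_n}}).

Lemma mem_cedges s e x : uniq s -> e \in cedges s -> x \in e -> x \in s.
Proof. by move=> us /(cedgesP _ us)[y ys ->] /set2P[]->; rewrite ?mem_next. Qed.

Lemma pairwise_disjointP ss s t : pairwise (fun s t => [disjoint s & t]) ss ->
  s \in ss -> t \in ss -> forall x, x \in s -> x \in t -> s = t.
Proof.
elim: ss => //= r ss IH /andP[/allP rss dss].
have dr t' x : t' \in ss -> x \in r -> x \in t' -> False.
  by move=> /rss /pred0P/(_ x) /=; case: (x \in r) (x \in t') => [[]|].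
rewrite !inE => /predU1P[->|sss] /predU1P[->|tss] x xs xt //.
- by have := dr _ _ tss xs xt.
- by have := dr _ _ sss xt xs.
- exact: IH xs xt.
Qed.

Lemma decomp_VF F ss : decomp adj F ss -> VF F = \bigcup_(s <- ss) [set y in s].
Proof.
case=> /allP cs _ ->; apply/setP => x; apply/bigcupP/mem_bigcup_seq.
  case=> e /mem_bigcup_seq[s sss es] xe; exists s; rewrite // inE.
  by case/and3P: (cs _ sss) => us _ _; apply: mem_cedges es xe.
case=> s sss; rewrite inE => xs; exists [set x; next s x]; last exact: set21.
apply/mem_bigcup_seq; exists s => //; case/and3P: (cs _ sss) => us _ _.
by apply/(cedgesP _ us); exists x.
Qed.

(** Each cycle is connected, and by disjointness no edge of [F] leaves it, so it is exactly one
    component. *)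
Lemma decomp_ncomp F ss : decomp adj F ss -> ncomp F = size ss.
Proof.
move=> dF; rewrite /ncomp (decomp_VF dF); case: dF => /allP cs dss FE.
set e := fun u v => _.
have cyc_ss s : s \in ss -> uniq s /\ (2 < size s)%N.
  by case/cs/and3P.
have e_sym : connect_sym e.
  by apply: sym_connect_sym => u v; rewrite /e setUC.
have e_closed s : s \in ss -> closed e (mem s).
  move=> sss; apply: (intro_closed e_sym) => u v; rewrite /e FE /= => /mem_bigcup_seq[t tss et] us.
  have [ut _] := cyc_ss _ tss.
  have ut' : u \in t by apply: mem_cedges et _; rewrite // set21.
  by rewrite (pairwise_disjointP dss sss tss us ut'); apply: mem_cedges et _; rewrite // set22.
have n1 s : s \in ss -> n_comp e (mem s) = 1%N.
  move=> sss; have [us sz] := cyc_ss _ sss.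
  have [x xs] : exists x, x \in s by case: (s) sz => // x s' _; exists x; rewrite inE eqxx.
  rewrite -(n_comp_connect e_sym x); apply: eq_n_comp_r => y.
  apply/idP/idP => [|/(closed_connect (e_closed _ sss))]; last by rewrite /= => <-.
  rewrite inE; move: y; apply: (@next_closed_all _ s (connect e x) x) => // y ys exy.
  apply: connect_trans exy (connect1 _); rewrite /e FE; apply/mem_bigcup_seq.
  by exists s => //; apply/(cedgesP _ us); exists y.
(* The relation [e] stays that of the whole [F]; only the set of vertices whose components are
   counted varies. *)
elim: ss dss {cs e_closed FE cyc_ss} n1 => [|s ss IH] /= => [_ _|/andP[/allP dss pss] n1].
  by apply: eq_card0 => x; rewrite !inE /= big_nil inE andbF.
rewrite -{}IH //; last by move=> t tss; apply: n1; rewrite inE tss orbT.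
rewrite -[RHS]add1n -[X in (X + _)%N](n1 s (mem_head _ _)) /n_comp_mem -cardUI [X in _ = (_ + X)%N]eq_card0 ?addn0.
  by apply: eq_card => x; rewrite !inE /= big_cons !inE -andb_orr.
move=> x; rewrite !inE /=; apply/negP => /andP[/andP[_ xs] /andP[_ /mem_bigcup_seq[t /dss]]].
by move=> /pred0P/(_ x) /=; rewrite xs inE /= => ->.
Qed.

(** The cycles are the long orbits of [p], listed once each through their canonical roots. *)
Lemma ledges_decomp (p : {perm 'I_n}) : (forall i, p i != i -> adj i (p i)) ->
  exists ss, decomp adj (ledges p) ss.
Proof.
move=> padj; pose long := [pred x | p (p x) != x].
have orbit_long x y : y \in orbit p x -> long x -> long y.
  rewrite -fconnect_orbit => /iter_findex <- lx; elim: (findex _ _ _) => //= m.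
  by rewrite (inj_eq perm_inj).
have longN x : long x -> p x != x by apply: contra => /eqP px; rewrite !px.
have next_orbit x y : y \in orbit p x -> next (orbit p x) y = p y.
  by apply: nextE; apply: cycle_orbit; apply: perm_inj.
exists [seq orbit p x | x <- enum [pred x | froots p x && long x]]; split.
- apply/allP => _ /mapP[x + ->]; rewrite mem_enum => /andP[_ lx].
  apply/and3P; split; first exact: orbit_uniq.
    (* These three points are distinct, which gives length at least 3. *)
    have : (size [:: x; p x; p (p x)] <= size (orbit p x))%N.
      apply: uniq_leq_size.
        rewrite /= !inE negb_or !andbT (inj_eq perm_inj).
        by move: (lx) (longN _ lx); rewrite /= eq_sym => -> ; rewrite eq_sym => ->.
      have ox := in_orbit p x; have opx := mem_orbit ox; have oppx := mem_orbit opx.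
      by move=> y; rewrite !inE => /or3P[]/eqP->.
    by [].
  apply: cycle_from_next; first exact: orbit_uniq.
  move=> y yx; rewrite next_orbit //; apply/padj/longN.
  exact: orbit_long yx lx.
- rewrite pairwise_map; set xs := enum _.
  have rxs x : x \in xs -> froot p x = x by rewrite mem_enum => /andP[/eqP].
  have : pairwise [rel x y | x != y] xs by rewrite -uniq_pairwise enum_uniq.
  apply: (@sub_in_pairwise _ (mem xs)); last by apply/allP.
  move=> x y /rxs rx /rxs ry xy.
  apply/pred0P => z /=; apply/negP; rewrite -!fconnect_orbit => /andP[xz yz].
  have sp := fconnect_sym (@perm_inj _ p).
  by case/eqP: xy; rewrite -rx -ry; apply/(fingraph.rootP sp); apply: connect_trans xz _; rewrite sp.
- apply/setP => e; apply/pedgesP/mem_bigcup_seq => [[i li ->]|[_ /mapP[x + ->]]].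
    have sp := fconnect_sym (@perm_inj _ p).
    have ir : i \in orbit p (froot p i) by rewrite -fconnect_orbit sp connect_root.
    exists (orbit p (froot p i)).
      apply: map_f; rewrite mem_enum inE /= (roots_root sp) /=.
      apply: (orbit_long i) => //.
      by rewrite -fconnect_orbit connect_root.
    by apply/(cedgesP _ (orbit_uniq _ _)); exists i; rewrite ?next_orbit.
  rewrite mem_enum => /andP[_ lx] /(cedgesP _ (orbit_uniq _ _))[y yx ->].
  by rewrite next_orbit //; exists y => //; apply: orbit_long yx lx.
Qed.

Variables (R : comNzRingType) (a : 'I_n -> 'I_n -> R).

(** Repeated use of [lsum_peel]; the induction is over all [U] because each cycle takes its vertices
    away. *)
Lemma lsum_decomp F ss (U : {set 'I_n}) : decomp adj F ss -> VF F \subset U ->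
  lsum a U F =
  (\prod_(s <- ss) (pterm a [set y in s] (cperm s) + pterm a [set y in s] (cperm (rev s))))
  * lsum a (U :\: VF F) set0.
Proof.
move=> dF; rewrite (decomp_VF dF); case: dF => cs dss ->.
elim: ss cs dss U => [|s ss IH] /=; first by move=> _ _ U _; rewrite !big_nil mul1r setD0.
move=> /andP[/and3P[us sz _] cs] /andP[/allP dsss dss] U; rewrite !big_cons.
rewrite subUset => /andP[sU ssU]; rewrite lsum_peel //; last first.
  move=> e /mem_bigcup_seq[t tss et]; apply/pred0P => x /=; apply/negP => /andP[xe xs].
  have /pred0P/(_ x) /= := dsss _ tss; rewrite xs /=.
  have /and3P[ut _ _] := allP cs _ tss.
  by rewrite (mem_cedges ut et xe).
rewrite IH //; first by rewrite mulrA setDDl.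
rewrite subsetD ssU; apply/pred0P => x /=; apply/negP => /andP[/mem_bigcup_seq[t tss]].
rewrite !inE => xt xs; have /pred0P/(_ x) /= := dsss _ tss.
by rewrite xs xt.
Qed.

End Decompositions.

(** * Involutions, matchings and the polynomial eta *)

Lemma prodrB_subset (R : comNzRingType) (I : finType) (D : {set I}) (x y : I -> R) :
  \prod_(i in D) (x i - y i)
  = \sum_(J : {set I} | J \subset D)
      ((-1) ^+ #|J| * \prod_(i in J) y i) * \prod_(i in D :\: J) x i.
Proof.
rewrite big_mkcond /=.
(* Outside [D] the factor is written [0 + 1], so that the expansion may run over all [J] and those
   not inside [D] vanish. *)
transitivity (\prod_i ((if i \in D then - y i else 0) + (if i \in D then x i else 1))).
  by apply: eq_bigr => i _; case: ifP; rewrite ?add0r // addrC.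
rewrite bigA_distr (bigID (fun J : {set I} => J \subset D)) /= [X in _ + X]big1 ?addr0.
  apply: eq_bigr => J JD; rewrite (bigID (mem J)) /=; congr (_ * _).
    by rewrite -prodrN; apply: eq_bigr => i iJ; rewrite iJ (subsetP JD).
  rewrite big_mkcond [RHS]big_mkcond; apply: eq_bigr => i _; rewrite inE.
  by case: (i \in J); case: (i \in D).
by move=> J /subsetPn[i iJ iD]; rewrite (bigD1 i) //= iJ (negPf iD) mul0r.
Qed.

Section Weights.
Variables (n : nat) (C : numClosedFieldType) (adj : rel 'I_n)
  (w : {set 'I_n} -> C) (w1 : 'I_n -> C).
Hypotheses (adj_sym : symmetric adj) (adj_irr : irreflexive adj).
Implicit Types (U S : {set 'I_n}) (M F : {set {set 'I_n}}) (p : {perm 'I_n}).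

Let b := bw adj w w1.

Definition entry (i j : 'I_n) : {poly C} := 'X *+ (i == j) - (b i j)%:P.

Lemma is_edgeP e :
  reflect (exists u v, adj u v /\ e = [set u; v]) (is_edge adj e).
Proof.
apply: (iffP existsP) => [[u /existsP[v /andP[uv /eqP->]]]|[u [v [uv ->]]]].
  by exists u, v.
by exists u; apply/existsP; exists v; rewrite uv eqxx.
Qed.

Lemma adj_neq u v : adj u v -> u != v.
Proof. by apply: contraTneq => ->; rewrite adj_irr. Qed.

Lemma matchingP S M :
  reflect ({in M, forall e, is_edge adj e /\ e \subset S} /\ trivIset M)
          (matching adj S M).
Proof.
rewrite /matching; apply: (iffP andP) => -[eM dM]; split.
- by move=> e /(forall_inP eM)/andP.
- by apply/trivIsetP => e f eM' fM; apply/implyP/(forall_inP (forall_inP dM _ eM')).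
- by apply/forall_inP => e /eM[-> ->].
apply/forall_inP => e eM'; apply/forall_inP => f fM; apply/implyP.
exact: (trivIsetP dM).
Qed.

Lemma VF_subset M U : (VF M \subset U) = [forall e in M, e \subset U].
Proof. by apply/bigcupsP/forall_inP. Qed.

Lemma card_VF S M : matching adj S M -> #|VF M| = (#|M|).*2.
Proof.
case/matchingP => eM; rewrite /trivIset => /eqP <-.
rewrite -mul2n mulnC -sum_nat_const; apply: eq_bigr => e /eM[/is_edgeP[u [v [uv ->]]] _].
by rewrite cards2 adj_neq.
Qed.

(** After exchanging the sums, a fixed [M] is summed over the sets [S] containing its vertices. The
    complements [U :\: S] are then arbitrary sets of unmatched vertices, and the sum is an expanded
    product. *)
Lemma etawE U : etaw adj w w1 U =
  \sum_(M | matching adj U M)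
    ((-1) ^+ #|M| * `|\prod_(e in M) w e| ^+ 2)
      *: \prod_(i in U :\: VF M) ('X - (w1 i)%:P).
Proof.
rewrite /etaw /muw; under eq_bigr do rewrite scaler_sumr.
rewrite (exchange_big_dep (matching adj U)) /=; last first.
  move=> S M SU /matchingP[eM tM]; apply/matchingP; split=> // e /eM[-> eS].
  by split=> //; apply: subset_trans eS SU.
apply: eq_bigr => M mM; under eq_bigr do rewrite scalerA mulrC -scalerA.
rewrite -scaler_sumr; congr (_ *: _).
have VU : VF M \subset U.
  by rewrite VF_subset; apply/forall_inP => e; case/matchingP: mM => eM _ /eM[].
(* With [J] for the complement of [S] in [U]; the second conjunct is the side condition of the
   reindexing below and amounts to [J \subset U]. *)
have condE J : matching adj (U :\: J) M && (U :\: (U :\: J) == J)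
    = (J \subset U :\: VF M).
  apply/andP/idP => [[mJ /eqP JU]|].
    apply/subsetP => i iJ; have : i \in U :\: (U :\: J) by rewrite JU.
    rewrite !inE => /andP[_ iU]; rewrite iU andbT; apply/negP => /bigcupP[e eM ie].
    case/matchingP: mJ => /(_ e eM)[_ /subsetP/(_ i ie)].
    by rewrite inE iJ.
  rewrite subsetD => /andP[JU JV]; rewrite setDDr setDv set0U (setIidPr JU); split=> //.
  apply/matchingP; case/matchingP: mM => eM tM; split=> // e eM'; have [-> eU] := eM _ eM'.
  split=> //; rewrite subsetD eU disjoint_sym /=.
  apply: disjointWr JV; exact: bigcup_sup.
rewrite prodrB_subset (reindex_onto (fun J => U :\: J) (fun S => U :\: S)) /=; last first.
  by move=> S /andP[SU _]; rewrite setDDr setDv set0U (setIidPr SU).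
apply: eq_big => [J|J]; rewrite subsetDl /= condE // => JD.
have [JU _] : J \subset U /\ true by move: JD; rewrite subsetD => /andP[].
rewrite setDDr setDv set0U (setIidPr JU).
rewrite -mul_polyC rmorphM rmorphXn rmorphN1 rmorph_prod; congr (_ * _).
(* Both exponents of ['X] count the vertices of [U] outside [J] and [VF M]. *)
rewrite prodr_const -(card_VF mM) cardsDS // cardsDS // cardsDS //.
by rewrite subnAC.
Qed.

Lemma bw_mul_sym u v : adj u v -> b u v * b v u = `|w [set u; v]| ^+ 2.
Proof.
move=> uv; have uNv := adj_neq uv; rewrite /b /bw [v == u]eq_sym (negPf uNv) [adj v u]adj_sym uv normCK.
rewrite [[set v; u]]setUC; case: ltngtP => // [|E]; first by rewrite mulrC.
by case/eqP: uNv; apply: val_inj.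
Qed.

Lemma entry_adj u v : entry u v != 0 -> u != v -> adj u v.
Proof.
rewrite /entry /b /bw => + uv; rewrite (negPf uv) mulr0n add0r oppr_eq0 polyC_eq0.
by case: ifP => // _; rewrite eqxx.
Qed.

(** Length at least 2 keeps the diagonal, and so ['X], out of the product; the signs of the entries
    and of the cycle differ by one factor -1. *)
Lemma pterm_cycle s : uniq s -> (1 < size s)%N ->
  pterm entry [set y in s] (cperm s)
  = - (\prod_(p <- zip s (rot 1 s)) b p.1 p.2)%:P.
Proof.
move=> us sz; rewrite /pterm odd_cperm //; last by case: (s) sz.
rewrite zip_rot1 // big_map /= big_uniq //= rmorph_prod.
rewrite (eq_bigl (mem s)) /=; last by move=> i; rewrite inE.
rewrite (eq_bigr (fun i => - (b i (next s i))%:P)); last first.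
  move=> i si; rewrite cpermE // /entry eq_sym (negPf (next_neq us sz si)).
  by rewrite mulr0n add0r.
rewrite prodrN (card_uniqP us) mulrA -[(-1) ^+ size s]signr_odd -signr_addb addNb addbb.
by rewrite expr1 mulN1r.
Qed.

(** Emptiness of [ledges p] says that [p] is an involution, and [medges p] is then its set of
    exchanged pairs. *)
Definition msum U M :=
  \sum_(p | perm_on U p && ((ledges p == set0) && (medges p == M))) pterm entry U p.

(** An involution having this pair agrees with [tperm u v] on it, so [sum_pterm_peel] splits off the
    transposition, whose sign is the minus. *)
Lemma msum_peel U M u v : u != v -> [set u; v] \in M -> trivIset M ->
  [set u; v] \subset U ->
  msum U M = - (entry u v * entry v u) * msum (U :\: [set u; v]) (M :\ [set u; v]).
Proof.
move=> uv eM /trivIsetP tM eU; set e := [set u; v] in eM eU *.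
have cE : perm_on e (tperm u v) by apply: tperm_on.
have -> : - (entry u v * entry v u) = pterm entry e (tperm u v).
  rewrite /pterm odd_tperm uv expr1 mulN1r /e big_setU1 ?inE //= big_set1.
  by rewrite tpermL tpermR.
pose P p := (ledges p == set0) && (medges p == M).
rewrite -(@sum_pterm_peel _ _ entry e U (tperm u v) P) // /P => [|p pUe].
  apply: eq_bigl => p; apply/andP/and3P => [[pU Pp]|[]//]; split=> //.
  case/andP: Pp => /eqP p0 /eqP pM.
  have pp i : p (p i) = i.
    apply/eqP; apply: contraTT isT => pi.
    have : [set i; p i] \in ledges p by apply/pedgesP; exists i.
    by rewrite p0 inE.
  have puv : p u = v.
    move: eM; rewrite -pM => /pedgesP[i pi /set2_inj]; rewrite eq_sym in pi.
    by case=> // -[-> ->].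
  apply/forall_inP => i; rewrite !inE => /orP[]/eqP->.
    by rewrite tpermL puv.
  by rewrite tpermR -puv pp.
have pe : perm_on (~: e) p by apply: subset_trans pUe _; rewrite setDE subsetIr.
rewrite !(pedgesM _ cE pe).
have -> : ledges (tperm u v) = set0.
  apply/setP => f; rewrite inE; apply/negP => /pedgesP[i].
  by rewrite /= tpermK eqxx.
have -> : medges (tperm u v) = [set e].
  apply/setP => f; rewrite inE; apply/pedgesP/eqP => [[i /=]|->].
    by case: tpermP => [->|->|]; rewrite ?eqxx // => _ -> //; rewrite setUC.
  by exists u => //=; rewrite tpermL // eq_sym.
rewrite set0U; congr (_ && _); apply/eqP/eqP => [<-|->]; last exact: setD1K.
rewrite setU1K //; apply/negP => /(pedges_disjoint pUe)/pred0P/(_ u).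
by rewrite /= set21.
Qed.

(** Induction on the number of edges: only the identity has none, and by [bw_mul_sym] each peeled
    edge gives minus its squared modulus. *)
Lemma msum_matching U M : matching adj U M -> msum U M =
  ((-1) ^+ #|M| * `|\prod_(e in M) w e| ^+ 2)
     *: \prod_(i in U :\: VF M) ('X - (w1 i)%:P).
Proof.
move: {2}#|M| (erefl #|M|) => m; elim: m U M => [|m IH] U M.
  move=> /cards0_eq -> _; rewrite /msum cards0 big_set0 normr1 expr1n mulr1 scale1r.
  rewrite (big_pred1 1%g) => [|p].
    rewrite /pterm odd_perm1 mul1r /VF big_set0 setD0; apply: eq_bigr => i _.
    by rewrite perm1 /entry /b /bw eqxx.
  apply/idP/eqP => [/and3P[_ _ /eqP p0]|->].
    apply/permP => i; rewrite perm1; apply/eqP; apply: contraTT isT => pi.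
    have : [set i; p i] \in medges p by apply/pedgesP; exists i.
    by rewrite p0 inE.
  rewrite perm_on1 /=; apply/andP; split; apply/eqP/setP => f; rewrite inE;
    by apply/negP => /pedgesP[i]; rewrite /= !perm1 eqxx.
move=> cM /matchingP[eM tM].
have /card_gt0P[e eMe] : (0 < #|M|)%N by rewrite cM.
have [/is_edgeP[u [v [uv eE]]] eU] := eM _ eMe; subst e.
set e := [set u; v] in eMe eU *.
rewrite (msum_peel (adj_neq uv) eMe tM eU) -/e.
have cM' : #|M :\ e| = m by apply/eqP; rewrite -eqSS -cM (cardsD1 e M) eMe.
rewrite IH //; last first.
  apply/matchingP; split; last by apply: trivIsetS tM; apply: subsetDl.
  move=> f /setD1P[fe fM]; have [-> fU] := eM _ fM; split=> //.
  by rewrite subsetD fU (trivIsetP tM).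
(* Deleting [e] and then the vertices of the other edges deletes exactly [VF M]. *)
rewrite setDDl -[e :|: _](big_setD1 e (F := id) eMe) -/(VF M) cM cM'.
rewrite -scalerAr -mul_polyC.
have -> : entry u v * entry v u = (`|w e| ^+ 2)%:P.
  rewrite /entry [v == u]eq_sym (negPf (adj_neq uv)) !mulr0n !add0r mulrNN -polyCM.
  by rewrite bw_mul_sym.
rewrite -polyCN !mul_polyC scalerA; congr (_ *: _).
rewrite [in RHS](big_setD1 e) //= normrM exprMn [(-1) ^+ m.+1]exprS mulN1r !(mulNr, mulrN).
by rewrite [in RHS]mulrA [in RHS]mulrAC.
Qed.

(** Involutions are grouped by their pairs. Distinct pairs are always disjoint, and a nonzero term
    makes each pair an edge, so only matchings contribute. *)
Lemma lsum0 U : lsum entry U set0 = etaw adj w w1 U.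
Proof.
rewrite etawE /lsum (bigID (fun p => matching adj U (medges p))) /=.
rewrite [X in _ + X]big1 ?addr0.
  rewrite (partition_big medges (matching adj U)) /=; last by move=> p /andP[].
  apply: eq_bigr => M mM; rewrite -msum_matching //; apply: eq_bigl => p.
  by rewrite [RHS]andbA; have [->|] := eqVneq (medges p) M; rewrite ?andbF // mM !andbT.
move=> p /andP[/andP[pU /eqP p0]]; apply: contraNeq => nz.
have eN i : i \in U -> entry i (p i) != 0.
  by move=> iU; apply: contraNneq nz => E; rewrite /pterm (bigD1 i) //= E mul0r mulr0.
have pp i : p (p i) = i.
  apply/eqP; apply: contraTT isT => pi.
  have : [set i; p i] \in ledges p by apply/pedgesP; exists i.
  by rewrite p0 inE.
apply/matchingP; split=> [e ep|].
  split; last exact: pedges_on pU ep.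
  case/pedgesP: ep => i /= pi ->; apply/is_edgeP; exists i, (p i); split=> //.
  apply: entry_adj; last by rewrite eq_sym.
  by apply: eN; apply: contraNT pi => iU; rewrite (out_perm pU).
(* Two pairs of an involution that share a point [k] coincide. *)
apply/trivIsetP => _ _ /pedgesP[i _ ->] /pedgesP[j _ ->]; apply: contraR => /pred0Pn[k].
rewrite /= !inE => /andP[]/orP[]/eqP-> /orP[/eqP<-|/eqP E]; rewrite ?pp //.
- by rewrite E pp setUC.
- by rewrite setUC.
- by rewrite (perm_inj E).
Qed.

End Weights.

(** * The characteristic polynomial: assembly and real coefficients *)

Lemma char_poly_tr (R : comNzRingType) (n : nat) (A : 'M[R]_n) :
  char_poly A^T = char_poly A.
Proof.
rewrite /char_poly -[RHS]det_tr; congr (\det _).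
by apply/matrixP => u v; rewrite !mxE eq_sym.
Qed.

Section CharPoly.
Variables (n : nat) (C : numClosedFieldType) (adj : rel 'I_n)
  (w : {set 'I_n} -> C) (w1 : 'I_n -> C).
Hypotheses (adj_sym : symmetric adj) (adj_irr : irreflexive adj).
Implicit Types (F : {set {set 'I_n}}) (p : {perm 'I_n}).

Local Notation entry := (entry adj w w1).

Lemma phiw_sum : phiw adj w w1 = \sum_F lsum entry setT F.
Proof.
rewrite /phiw /char_poly /determinant (partition_big (pedges 2) predT) //=.
apply: eq_bigr => F _; apply: eq_big => [p|p _]; first by have -> : perm_on setT p by apply/subsetP => i; rewrite inE.
rewrite /pterm; congr (_ * _); apply: eq_big => i; first by rewrite inE.
by rewrite !mxE.
Qed.

(** A nonzero term moves vertices along edges of the graph only, and then [ledges_decomp] puts [F]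
    into Gamma. *)
Lemma lsum_not_Gamma F : F != set0 -> ~ inGamma adj F -> lsum entry setT F = 0.
Proof.
move=> F0 GF; apply: big1 => p /andP[_ /eqP pF]; apply/eqP; apply: contra_notT GF => nz.
rewrite -pF; split; first by rewrite pF.
apply: ledges_decomp => i pi; apply: (@entry_adj _ _ adj w w1); last by rewrite eq_sym.
by apply: contraNneq nz => E; rewrite /pterm (bigD1 i) ?inE //= E mul0r mulr0.
Qed.

Lemma inGammaP F : reflect (inGamma adj F) (inGammab adj F).
Proof.
by rewrite /inGammab; case: excluded_middle_informative => GF; constructor.
Qed.

Lemma decP F : inGamma adj F -> decomp adj F (dec adj F).
Proof.
case=> _ Fss; rewrite /dec; case: excluded_middle_informative => // h.
exact: proj2_sig.
Qed.

(** The two directions of a cycle give the two products in [w2seq], with one minus sign per cycle,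
    and [decomp_ncomp] counts these signs. The argument works for every decomposition, hence for the
    chosen one. *)
Lemma lsum_Gamma F : inGamma adj F ->
  lsum entry setT F = ((-1) ^+ ncomp F * w2 adj w w1 F) *: etaw adj w w1 (~: VF F).
Proof.
move=> /decP dF; rewrite (decomp_ncomp dF) (lsum_decomp _ dF) ?subsetT //.
rewrite setTD lsum0 // -mul_polyC /w2; congr (_ * _).
case: dF => /allP cs _ _; elim: (dec adj F) cs => [|s ss IH] cs.
  by rewrite !big_nil mulr1.
rewrite !big_cons IH => [|t tss]; last by apply: cs; rewrite inE tss orbT.
have /and3P[us sz _] := cs s (mem_head _ _).
have rs : [set y in s] = [set y in rev s] by apply/setP => y; rewrite !inE mem_rev.
rewrite [in X in _ + X]rs !pterm_cycle ?rev_uniq ?size_rev ?(ltnW sz) //.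
rewrite -opprD -polyCD -/(w2seq _ _ _ s) -polyCN -polyCM; congr _%:P.
by rewrite exprS mulN1r !mulNr mulrCA.
Qed.

(** The matrix is Hermitian, so conjugating the coefficients amounts to transposing it, which
    preserves the characteristic polynomial. *)
Lemma phiw_real i : (forall v, w1 v \is Num.real) -> (phiw adj w w1)`_i \is Num.real.
Proof.
move=> w1R; apply/CrealP; rewrite -coef_map /= /phiw map_char_poly.
have -> : map_mx Num.conj (Bmx adj w w1) = (Bmx adj w w1)^T.
  apply/matrixP => u v; rewrite !mxE /bw eq_sym adj_sym [[set v; u]]setUC.
  case: eqVneq => [->|uv]; first by apply/CrealP.
  case: ifP => _; last exact: rmorph0.
  by case: ltngtP => [||E]; rewrite ?conjCK //; case/eqP: uv; apply: val_inj.
by rewrite char_poly_tr.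
Qed.

End CharPoly.
Unset Implicit Arguments.

Theorem theorem2p8 (n : nat) (C : numClosedFieldType) (adj : rel 'I_n)
  (w : {set 'I_n} -> C) (w1 : 'I_n -> C)
  (adj_sym : symmetric adj) (adj_irr : irreflexive adj)
  (w_nz : forall u v, adj u v -> w [set u; v] != 0)
  (w1_real : forall v, w1 v \is Num.real) :
  phiw adj w w1 =
    etaw adj w w1 [set: 'I_n]
    + \sum_(F : {set {set 'I_n}} | inGammab adj F)
        ((-1) ^+ ncomp F * w2 adj w w1 F) *: etaw adj w w1 (~: VF F)
  /\ (forall i, (phiw adj w w1)`_i \is Num.real).
Proof.
split; last by move=> i; apply: phiw_real.
(* The empty edge set is not in Gamma and accounts for the leading eta. *)
rewrite phiw_sum (bigD1 set0) //= lsum0 //; congr (_ + _).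
rewrite (bigID (inGammab adj)) /= [X in _ + X]big1 ?addr0 => [|F /andP[F0 /inGammaP]].
  apply: eq_big => [F|F /andP[_ /inGammaP]]; last exact: lsum_Gamma.
  by apply/andP/idP => [[]|GF] //; split=> //; case/inGammaP: GF.
exact: lsum_not_Gamma.
Qed.
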